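(* Let $n\ge 1$ and consider an $n\times n$ board with files $1,\dots,n$ and ranks $1,\dots,n$. A pawn-square is a square $s$ at file $f$ and rank $r$ with $2\le r\le n-1$; its set of potential starting files is $\mu_s=\{\,g\in\mathbb{Z}: \max(1,f-(r-2))\le g\le \min(n,f+(r-2))\,\}$. A (single-side pawn) diagram is a set $\nu$ of at most $n$ pawn-squares, each occupied by one pawn of a single colour. Let $G$ be the bipartite graph with vertex classes $\bigcup_{s\in\nu}\mu_s$ (files) and $\nu$ (pawn-squares), where a pawn-square $s$ is joined to a file $g$ iff $g\in\mu_s$. Then the diagram $\nu$ is reachable if and only if $G$ has a matching that saturates $\nu$ (a $|\nu|$-perfect matching).
   Context: Reachability model: the game starts with exactly one pawn on each square of rank $2$ (files $1,\dots,n$) and no other pawns. A move either (i) moves a pawn from file $f$, rank $r$ to an empty square on rank $r+1$ at file $f'$ with $|f'-f|\le 1$ and $1\le f'\le n$ (so pawns may move forward or diagonally forward without limit, diagonal moves being regarded as capturing empty squares), or (ii) removes (captures) a pawn from the board. A diagram is reachable if some finite sequence of moves from the starting position produces a position whose set of occupied squares is exactly $\nu$. *)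

(* Defs.v *)
From mathcomp Require Import all_boot.

Set Implicit Arguments.
Unset Strict Implicit.
Unset Printing Implicit Defensive.

(* Files and ranks of the n x n board are numbered from 1 to n, whereas the
   elements of 'I_n are numbered from 0: the ordinal i stands for the file
   (or rank) i.+1. *)
Definition square (n : nat) : finType := ('I_n * 'I_n)%type.

Definition label n (i : 'I_n) : nat := i.+1.
Definition file n (s : square n) : nat := label s.1.
Definition rank n (s : square n) : nat := label s.2.

Definition pawn_square n (s : square n) : bool := 2 <= rank s <= n.-1.

(* On pawn-squares the subtraction rank s - 2 is exact; truncation of the outer
   subtraction is harmless because of the maximum with 1. *)
Definition starting_files n (s : square n) : {set 'I_n} :=
  [set g : 'I_n | maxn 1 (file s - (rank s - 2)) <= label g
                  <= minn n (file s + (rank s - 2))].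

Definition diagram n (nu : {set square n}) : Prop :=
  {in nu, forall s, pawn_square s} /\ #|nu| <= n.

(* A position is identified with its set of occupied squares: a square never
   holds more than one pawn, and pawns have no identity beyond their square. *)
Definition position (n : nat) : finType := {set square n}.

Definition start n : position n := [set s | rank s == 2].

Definition advance n (P Q : position n) : bool :=
  [exists s : square n, exists t : square n,
    [&& s \in P, t \notin P, rank t == (rank s).+1,
        (file t <= (file s).+1) && (file s <= (file t).+1)
      & Q == t |: (P :\ s)]].

Definition removal n (P Q : position n) : bool :=
  [exists s : square n, (s \in P) && (Q == P :\ s)].

Definition move n : rel (position n) :=
  [rel P Q | advance P Q || removal P Q].

Definition reachable n (nu : {set square n}) : Prop :=
  exists2 p : seq (position n), path (@move n) (start n) p
                              & last (start n) p = nu.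

(* The edges are the adjacent pairs in left_class x right_class; the value of
   adjacent elsewhere is irrelevant. *)
Record bigraph (L R : finType) := Bigraph {
  left_class : {set L};
  right_class : {set R};
  adjacent : L -> R -> bool
}.

Definition edges (L R : finType) (G : bigraph L R) : {set L * R} :=
  [set e in setX (left_class G) (right_class G) | adjacent G e.1 e.2].

Definition matching (L R : finType) (G : bigraph L R) (M : {set L * R}) : Prop :=
  M \subset edges G /\
  {in M &, forall e e', e != e' -> e.1 != e'.1 /\ e.2 != e'.2}.

Definition saturates_right (L R : finType) (M : {set L * R}) (B : {set R}) :
  Prop := {in B, forall s, exists2 e, e \in M & e.2 = s}.

Definition pawn_graph n (nu : {set square n}) : bigraph 'I_n (square n) :=
  Bigraph (\bigcup_(s in nu) starting_files s) nu
          (fun g s => g \in starting_files s).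

(* Main.v *)
Require Import Defs.
From mathcomp Require Import all_boot.
From mathcomp Require Import zify.

Set Implicit Arguments.
Unset Strict Implicit.
Unset Printing Implicit Defensive.

(** If every pawn of a position is assigned a potential starting file, no two
    pawns sharing one, then moves preserve the existence of such an assignment.
    Conversely, retract a pawn of least rank r > 2 by one step towards its
    assigned file. The square it retracts to is empty: for r > 3 there are no
    pawns at rank r - 1 at all, and for r = 3 that square is the very starting
    square assigned to the pawn. Iterating leads back to a set of pawns
    on rank 2, which is reached from the start by removals alone. *)

(** The clamps to 1 and [n] hold for every ordinal, and the shift from ordinals to labels cancels
    between [g] and [s.1]. What remains is the distance bound, free of truncated subtraction. *)
Lemma mem_starting_files n (s : square n) (g : 'I_n) : 2 <= rank s ->
  (g \in starting_files s)
  = (s.1 + 2 <= g + rank s) && (g + 2 <= s.1 + rank s).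
Proof.
rewrite inE /file /label => hr; have ltgn := ltn_ord g.
by apply/idP/idP; lia.
Qed.

(** The rank bound is part of the invariant because truncated subtraction gives a square of rank 1 a
    nonempty set of starting files. *)
Definition start_assignment n (P : position n) (a : square n -> 'I_n) : Prop :=
  {in P &, injective a} /\
  {in P, forall s, 2 <= rank s /\ a s \in starting_files s}.

Definition assignable n (P : position n) : Prop :=
  exists a, start_assignment P a.

Lemma assignable_start n : assignable (start n).
Proof.
exists fst; split=> [[f r] [f' r']|[f r]].
  rewrite !inE /= => /eqP hr /eqP hr' eqf; congr pair => //.
  by apply/val_inj/succn_inj; rewrite [RHS]hr'.
rewrite inE => /eqP hr; have hr2 : 2 <= rank (f, r) by rewrite hr.
by rewrite mem_starting_files // hr /=; split=> //; lia.
Qed.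

Lemma assignable_sub n (P Q : position n) :
  Q \subset P -> assignable P -> assignable Q.
Proof.
move=> /subsetP sQP [a [inj_a a_start]]; exists a; split.
  by move=> x y /sQP hx /sQP hy; apply: inj_a.
by move=> x /sQP; apply: a_start.
Qed.

(** Removing [s] frees the file [a s], so handing it to [t] keeps the assignment injective. This
    serves both forward moves and retractions. *)
Lemma start_assignment_exchange n (P : position n) (a : square n -> 'I_n)
    (s t : square n) :
  start_assignment P a -> s \in P -> 2 <= rank t -> a s \in starting_files t ->
  start_assignment (t |: P :\ s) (fun x => if x == t then a s else a x).
Proof.
move=> [inj_a a_start] sP ht ast; split=> [x y|x]; rewrite !(in_setU1, in_setD1).
  case: (eqVneq x t) => [->|_]; case: (eqVneq y t) => [->|_] //=.
  - by move=> _ /andP[ys yP] /(inj_a _ _ sP yP) eys; rewrite eys eqxx in ys.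
  - by move=> /andP[xs xP] _ /(inj_a _ _ xP sP) exs; rewrite exs eqxx in xs.
  by move=> /andP[_ xP] /andP[_ yP]; apply: inj_a.
case: (eqVneq x t) => [->|_] //= /andP[_ xP]; exact: a_start.
Qed.

Lemma assignable_move n (P Q : position n) :
  move P Q -> assignable P -> assignable Q.
Proof.
case/orP=> [/existsP[s /existsP[t]]|/existsP[s /andP[_ /eqP->]]]; last first.
  exact/assignable_sub/subsetDl.
case/and5P=> sP _ /eqP rt ft /eqP-> [a aP].
have [rs] := aP.2 s sP; rewrite mem_starting_files // => as_s.
have rt2 : 2 <= rank t by rewrite rt; lia.
exists (fun x => if x == t then a s else a x).
(* One rank up, the window of starting files widens by one on each side, which absorbs a file shift
   of at most one. *)
apply: start_assignment_exchange => //; rewrite mem_starting_files // rt.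
by move: ft as_s; rewrite /file /label; lia.
Qed.

Lemma reachableP n (nu : position n) :
  reachable nu <-> connect (@move n) (start n) nu.
Proof.
by split=> [[p]|/connectP[p]]; [move=> hp <-; apply/connectP; exists p|exists p].
Qed.

Lemma assignable_connect n (P Q : position n) :
  connect (@move n) P Q -> assignable P -> assignable Q.
Proof.
case/connectP=> p; elim: p P => [|R p IHp] P /=; first by move=> _ ->.
by case/andP=> mPR pR eQ aP; apply: (IHp R) => //; apply: assignable_move aP.
Qed.

Lemma connect_sub n (P Q : position n) :
  Q \subset P -> connect (@move n) P Q.
Proof.
have [k] := ubnP #|P :\: Q|; elim: k P => // k IHk P leP sQP.
have [/eqP|[s sPQ]] := set_0Vmem (P :\: Q).
  rewrite setD_eq0 => sPQ.
  by have -> : P = Q by apply/eqP; rewrite eqEsubset sPQ sQP.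
have /setDP[sP sQ] := sPQ.
apply: (@connect_trans _ _ (P :\ s)).
  by apply/connect1/orP; right; apply/existsP; exists s; rewrite sP eqxx.
apply: IHk; last by rewrite subsetD1 sQP sQ.
by move: leP; rewrite (cardsD1 s) sPQ setDDl [Q :|: _]setUC -setDDl; lia.
Qed.

Lemma retraction n (s : square n) (g : 'I_n) :
  2 < rank s -> g \in starting_files s ->
  exists t : square n,
    [/\ rank s = (rank t).+1,
        (file s <= (file t).+1) && (file t <= (file s).+1)
      & g \in starting_files t].
Proof.
case: s => f r hr; rewrite mem_starting_files; last exact: ltnW.
have ltr : r.-1 < n by have := ltn_ord r; lia.
(* The new file is one step closer to [g], or unchanged if already equal to [g]; this compensates
   for the narrower window one rank lower. *)
have ltf : (if g < f then f.-1 else if f < g then f.+1 else f) < n.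
  by have := ltn_ord g; have := ltn_ord f; do 2?case: ifP; lia.
move: hr; rewrite /rank /label /= => hr gf.
exists (Ordinal ltf, Ordinal ltr).
rewrite mem_starting_files /file /rank /label /=; last by lia.
by split; do 2?case: ifP; lia.
Qed.

Lemma assignable_reachable n (P : position n) :
  assignable P -> connect (@move n) (start n) P.
Proof.
(* Induction on the sum of the ranks, which each retraction lowers by one. *)
have [k] := ubnP (\sum_(s in P) rank s); elim: k P => // k IHk P leP [a aP].
have [/existsP[s0 s0P]|none] :=
    boolP [exists s : square n, (s \in P) && (2 < rank s)]; last first.
  apply/connect_sub/subsetP=> s sP; rewrite inE.
  have [rs _] := aP.2 s sP; move: none; rewrite negb_exists => /forallP/(_ s).
  by rewrite sP /=; lia.
pose high s := (s \in P) && (2 < rank s).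
case: (@arg_minnP _ s0 high (@rank n) s0P) => s /andP[sP rs] min_s {s0 s0P}.
have [_ as_s] := aP.2 s sP.
have [t [rt ft at_t]] := retraction rs as_s.
have rt2 : 2 <= rank t by lia.
have tP : t \notin P.
  apply/negP=> tP.
  have rt_eq : rank t = 2.
    by have := min_s t; rewrite /high tP /=; lia.
  have [_ a_t] := aP.2 t tP.
  (* On rank 2 the only starting file is the pawn's own, so both values equal [t.1]. *)
  have eq_a : a t = a s.
    apply: val_inj; move: a_t at_t; rewrite !mem_starting_files // rt_eq /=.
    by lia.
  by have := aP.1 _ _ tP sP eq_a => ets; rewrite ets in rt; lia.
have tPs : t \notin P :\ s by rewrite inE (negPf tP) andbF.
apply: (@connect_trans _ _ (t |: P :\ s)).
  apply: IHk; last first.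
    by exists (fun x => if x == t then a s else a x);
       apply: start_assignment_exchange.
  by move: leP; rewrite (big_setD1 s sP) (big_setU1 _ tPs) /= rt; lia.
(* The retraction is undone by a legal advance from [t] to the vacated square [s], which restores
   [P]. *)
apply/connect1/orP; left; apply/existsP; exists t; apply/existsP; exists s.
have neq_st : s != t by apply: contraNneq tP => <-.
by rewrite setU11 !inE eqxx (negPf neq_st) /= rt eqxx ft setU1K // setD1K //=.
Qed.

Lemma assignable_matching n (nu : {set square n}) :
  {in nu, forall s, 2 <= rank s} ->
  assignable nu <->
  exists M : {set 'I_n * square n},
    matching (pawn_graph nu) M /\ saturates_right M nu.
Proof.
move=> rk; split=> [[a [inj_a a_start]]|[M [[/subsetP sub disj] sat]]].
  exists [set (a s, s) | s in nu]; split; last first.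
    by move=> s sP; exists (a s, s) => //; apply: imset_f.
  split.
    apply/subsetP=> _ /imsetP[s sP ->]; have [_ as_s] := a_start s sP.
    by rewrite !inE /= sP as_s !andbT; apply/bigcupP; exists s.
  move=> _ _ /imsetP[s sP ->] /imsetP[t tP ->] /= neq.
  have neq_st : s != t by apply: contraNneq neq => ->.
  split=> //; apply: contraNneq neq_st => /(inj_a _ _ sP tP) ->.
  exact: eqxx.
have [->|[s0 s0P]] := set_0Vmem nu.
  by exists fst; split=> [x y|x]; rewrite inE.
have [[g0 _] _ _] := sat s0 s0P.
pose a s := odflt g0 [pick g | (g, s) \in M].
have aM s : s \in nu -> (a s, s) \in M.
  move=> /sat[[g s'] gM /= eqs]; rewrite /a; case: pickP => [//|/(_ g)].
  by rewrite -eqs gM.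
exists a; split=> [x y xP yP eq_a|s sP].
  apply/eqP; apply: contraT => neq.
  have [] := disj _ _ (aM x xP) (aM y yP); last by rewrite /= eq_a eqxx.
  by apply: contraNneq neq => -[_ ->].
by split; [apply: rk | have := sub _ (aM s sP); rewrite inE => /andP[]].
Qed.

Theorem theorem1 (n : nat) (hn : 1 <= n) (nu : {set square n})
  (hnu : diagram nu) :
  reachable nu <->
  exists M : {set 'I_n * square n},
    matching (pawn_graph nu) M /\ saturates_right M nu.
Proof.
have rk : {in nu, forall s, 2 <= rank s} by move=> s /hnu.1 /andP[].
apply: iff_trans (reachableP nu) _; apply: iff_trans _ (assignable_matching rk).
split=> [reach|]; last exact: assignable_reachable.
exact: assignable_connect reach (assignable_start n).
Qed.
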